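(* Let $(\mathcal N,\mathcal O)$ be an oriented plabic network representing $[A]$, with boundary sources indexed by $I=\{i_1<\dots<i_k\}$, and consider two gauge ray directions $\mathfrak l$ and $\mathfrak l'$. (1) For any boundary source edge $e_{i_r}$ (the edge at $b_{i_r}$) the edge vector $E_{e_{i_r}}$ does not depend on the gauge direction $\mathfrak l$, and it coincides with the $r$-th row $A[r]$ of the generalized reduced row echelon form of $[A]$ associated to the pivot set $I$, minus the $i_r$-th vector $E_{i_r}$ of the canonical basis: $E_{e_{i_r}}=A[r]-E_{i_r}$. (2) For any other edge $e$, $$E'_e=(-1)^{\mathrm{cr}(V_e)+\mathrm{par}(e)}E_e,$$ where $E_e$ and $E'_e$ are the edge vectors of $e$ for the gauge directions $\mathfrak l$ and $\mathfrak l'$ respectively, $\mathrm{par}(e)$ is $1$ if $e$ (as a direction) belongs to the angle $\widehat{\mathfrak l,\mathfrak l'}$ and $0$ otherwise, and $\mathrm{cr}(V_e)$ denotes the number of gauge rays passing the initial vertex $V_e$ of $e$ during the rotation from $\mathfrak l$ to $\mathfrak l'$ inside the disk.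
   Context: Fix positive integers $k<n$. A plabic graph $\mathcal G$ of type $(k,n)$ is a finite directed graph drawn planarly in a disk, with no component isolated from the boundary, such that: it has $n$ boundary vertices $b_1,\dots,b_n$ labelled clockwise, all on a common straight interval of the boundary of the disk, each of degree 1 (a boundary source if its edge is outgoing, a boundary sink if incoming; exactly $k$ are sources); all other (internal) vertices are strictly inside the disk and are bivalent or trivalent; each internal vertex either has exactly one incoming edge (white) or exactly one outgoing edge (black), bivalent vertices being assigned either colour. Edges are straight segments, regarded as vectors directed by the orientation $\mathcal O$. A plabic network $\mathcal N$ is a plabic graph with a positive weight $w_e$ on each edge; $\bar I=[n]\setminus I$. $\mathcal N$ represents $[A]$ if $[A]$ is the class of the matrix with identity submatrix in the columns $I$ (this representative is the generalized reduced row echelon form with pivot set $I$) and entries $A^r_j=(-1)^{\sigma(i_r,j)}\sum_{P:b_{i_r}\to b_j}(-1)^{\mathrm{wind}_{top}(P)}w(P)$ for $j\in\bar I$, where $\sigma(i_r,j)$ is the number of elements of $I$ strictly between $i_r$ and $j$, the sum is over directed walks (it sums to a rational function of the weights), and $\mathrm{wind}_{top}$ is the topological winding index ($(-1)^{\mathrm{wind}_{top}(P)}=(-1)^{\text{number of loops removed in the loop erasure of }P}$). A gauge ray direction $\mathfrak l$ is an oriented direction such that the ray in direction $\mathfrak l$ from any boundary vertex points inside the disk, no internal edge is parallel to $\mathfrak l$, and the rays starting at boundary vertices contain no internal vertices. The gauge rays are the rays $\mathfrak l_{i_r}$ in direction $\mathfrak l$ starting at the boundary sources $b_{i_r}$.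 The rotation from $\mathfrak l$ to $\mathfrak l'$ is the monotone rotation through directions pointing inside the disk at the boundary vertices, and $\widehat{\mathfrak l,\mathfrak l'}$ is the angle swept. For plane vectors $s(u,v)=+1,0,-1$ if $(u,v)$ is positively (counterclockwise) oriented, parallel, negatively oriented. For consecutive edges, $\mathrm{wind}(e,f)=\pm1$ if $s(e,f)=s(e,\mathfrak l)=s(\mathfrak l,f)=\pm1$, and $0$ otherwise. $\mathrm{int}(e)$ is the number of intersections of $e$ with the gauge rays (the common starting point of $\mathfrak l_{i_r}$ and the edge at $b_{i_r}$ is not counted). For a directed path $\mathcal P=(e_1,\dots,e_m)$ (edges may repeat): $w(\mathcal P)=\prod w_{e_l}$ with multiplicity, $\mathrm{wind}(\mathcal P)=\sum_{l=1}^{m-1}\mathrm{wind}(e_l,e_{l+1})$, $\mathrm{int}(\mathcal P)=\sum_{l=1}^m\mathrm{int}(e_l)$. The edge vector $E_e\in\mathbb R^n$ has components $(E_e)_j=\sum_{\mathcal P:e\to b_j}(-1)^{\mathrm{wind}(\mathcal P)+\mathrm{int}(\mathcal P)}w(\mathcal P)$, the sum over all directed paths with first edge $e$ ending at $b_j$ (zero if there is none), understood as the rational function of the weights to which this series sums (its denominator is positive for positive weights). *)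

(* Defs.v *)
From HB Require Import structures.
From mathcomp Require Import all_boot all_order all_algebra.
From mathcomp Require mpoly.

Set Implicit Arguments.
Unset Strict Implicit.
Unset Printing Implicit Defensive.

(* [mpoly] is imported inside a module only: its notations clash with those of
   MathComp-Analysis, imported below. *)
Module WalkSeries.
Import mpoly.
Import GRing.Theory.
Local Open Scope ring_scope.

(* The formal power series c, given by its coefficients, is the expansion of a
   rational function P / Q (that is, Q * c = P coefficientwise) which is regular
   at w and takes the value x there. *)
Definition sums_to (R : fieldType) (N : nat) (c : 'X_{1..N} -> R)
    (w : 'I_N -> R) (x : R) : Prop :=
  exists P Q : {mpoly R[N]},
    [/\ forall m : 'X_{1..N},
          \sum_(h : 'X_{1..N < (mdeg m).+1, (mdeg m).+1} | m == (h.1 + h.2)%MM)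
             Q@_(h.1) * c h.2 = P@_m,
        Q.@[w] != 0
      & x = P.@[w] / Q.@[w]].

Lemma sums_to_unique (R : fieldType) (N : nat) (c : 'X_{1..N} -> R)
    (w : 'I_N -> R) (x y : R) : sums_to c w x -> sums_to c w y -> x = y.
Proof.
case=> P1 [Q1 [e1 nz1 ->]] [P2 [Q2 [e2 nz2 ->]]].
pose T d := \sum_(m : 'X_{1..N < d}) (c m *: 'X_[m]) : {mpoly R[N]}.
have TE Q P m d : (mdeg m < d)%N ->
    (forall m : 'X_{1..N},
      \sum_(h : 'X_{1..N < (mdeg m).+1, (mdeg m).+1} | m == (h.1 + h.2)%MM)
         Q@_(h.1) * c h.2 = P@_m) -> (Q * T d)@_m = P@_m.
  move=> lt_md e; rewrite -e mcoeffM; apply: eq_bigr => h _.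
  rewrite mcoeff_mpoly //; apply: leq_trans lt_md.
  exact: bmdeg.
have QP : Q2 * P1 = Q1 * P2.
  apply/mpolyP => m; pose d := (mdeg m).+1.
  have -> : (Q2 * P1)@_m = (Q2 * (Q1 * T d))@_m.
    rewrite !mcoeffM; apply: eq_bigr => h _; congr (_ * _).
    by apply/esym/TE => //; exact: bmdeg.
  have -> : (Q1 * P2)@_m = (Q1 * (Q2 * T d))@_m.
    rewrite !mcoeffM; apply: eq_bigr => h _; congr (_ * _).
    by apply/esym/TE => //; exact: bmdeg.
  by rewrite mulrCA.
have := congr1 (meval w) QP; rewrite !mevalM => QPw.
by apply/eqP; rewrite eqr_div // mulrC QPw mulrC.
Qed.

Section Walks.
Variables (R : fieldType) (T : finType).

(* The variables of the series are indexed by T through [enum_val]. *)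
Definition mult (s : seq T) : 'X_{1..#|T|} :=
  [multinom count_mem (enum_val i) s | i < #|T|].

Definition walk_coef (P : pred (seq T)) (sg : seq T -> int)
    (m : 'X_{1..#|T|}) : R :=
  \sum_(s : (mdeg m).-tuple T | P s && (mult s == m)) (-1) ^ sg s.

(* x is the value at the weights w of the rational function to which the series
   \sum_(s | P s) (-1) ^ (sg s) * \prod_(e <- s) w e sums. *)
Definition walk_sums_to (P : pred (seq T)) (sg : seq T -> int) (w : T -> R)
    (x : R) : Prop := sums_to (walk_coef P sg) (fun i => w (enum_val i)) x.

Lemma walk_sums_to_unique (P : pred (seq T)) (sg : seq T -> int) (w : T -> R)
    (x y : R) : walk_sums_to P sg w x -> walk_sums_to P sg w y -> x = y.
Proof. exact: sums_to_unique. Qed.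

End Walks.
End WalkSeries.

From mathcomp Require Import boolp classical_sets reals topology normedtype.
From mathcomp Require Import convex trigo.
Import Order.TTheory GRing.Theory Num.Theory numFieldNormedType.Exports.
Local Open Scope classical_set_scope.
Local Open Scope ring_scope.

(* The value is unique by [walk_sums_to_unique]. *)
Definition walk_sum (R : realType) (T : finType) (P : pred (seq T))
    (sg : seq T -> int) (w : T -> R) : R :=
  xget 0 [set x | WalkSeries.walk_sums_to P sg w x].

Section Plane.
Variable R : realType.
Implicit Types u v a b x : R * R.

Definition dot u v : R := u.1 * v.1 + u.2 * v.2.
Definition cross u v : R := u.1 * v.2 - u.2 * v.1.
Definition enorm u : R := Num.sqrt (dot u u).

Definition segment a b : set (R * R) :=
  [set x | exists2 t : R, 0 <= t <= 1 & x = a + t *: (b - a)].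

Definition orient u v : int := sgz (cross u v).

Definition points_inside (D : set (R * R)) a v : Prop :=
  \forall t \near (0 : R)^'+, interior D (a + t *: v).

(* Turning angle from u to v, counterclockwise positive; it is pi when u and v
   are opposite. *)
Definition turn u v : R :=
  let a := acos (dot u v / (enorm u * enorm v)) in
  if cross u v < 0 then - a else a.

(* The rotation from the direction l to the direction l': for l and l' in a
   common open half-plane, t |-> rotation l l' t runs monotonically through the
   directions of the angle between them. *)
Definition rotation (l l' : R * R) (t : R) : R * R := (1 - t) *: l + t *: l'.

End Plane.

Section Plabic.
Variables (R : realType) (k n : nat).

(* Vertices are 'I_n + inner, the left summand being the boundary vertices.
   [src] enumerates the boundary sources. *)
Record drawn_graph := DrawnGraph {
  inner : finType;
  edge : finType;
  tail : edge -> 'I_n + inner;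
  head : edge -> 'I_n + inner;
  white : pred inner;
  src : 'I_k -> 'I_n;
  pos : 'I_n + inner -> R * R;
  disk : set (R * R);
  ivl : R * R;
  ivr : R * R }.

Definition vertex (G : drawn_graph) : finType := ('I_n + inner G)%type.
Definition bdry (G : drawn_graph) (j : 'I_n) : vertex G := inl j.
Definition intr (G : drawn_graph) (v : inner G) : vertex G := inr v.

Definition indeg (G : drawn_graph) (v : vertex G) : nat :=
  #|[pred e : edge G | head e == v]|.
Definition outdeg (G : drawn_graph) (v : vertex G) : nat :=
  #|[pred e : edge G | tail e == v]|.

Definition incident (G : drawn_graph) (e : edge G) (v : vertex G) : bool :=
  (tail e == v) || (head e == v).

Definition adjacent (G : drawn_graph) : rel (vertex G) :=
  fun u v => [exists e : edge G, [&& incident e u, incident e v & u != v]].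

Definition vec (G : drawn_graph) (e : edge G) : R * R :=
  pos (head e) - pos (tail e).

Record is_plabic (G : drawn_graph) : Prop := IsPlabic {
  (* The disk is a convex body whose boundary contains the segment from [ivl]
     to [ivr]; the disk lies to the right of it, so that going from [ivl] to
     [ivr] is going clockwise along the boundary. *)
  disk_compact : compact (disk G);
  disk_convex : convex_set (disk G);
  disk_interior : interior (disk G) !=set0;
  ivl_neq_ivr : ivl G != ivr G;
  interval_boundary :
    segment (ivl G) (ivr G) `<=` disk G `\` interior (disk G);
  interval_clockwise : forall x, interior (disk G) x ->
    cross (ivr G - ivl G) (x - ivl G) < 0;
  boundary_pos : exists t : 'I_n -> R,
    [/\ {homo t : i j / (i < j)%N >-> i < j},
        forall j, 0 <= t j <= 1
      & forall j, pos (bdry G j) =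
                  ivl G + t j *: (ivr G - ivl G)];
  inner_pos : forall v : inner G, interior (disk G) (pos (intr v));
  pos_inj : injective (@pos G);
  no_loop : forall e : edge G, tail e != head e;
  planar : forall (e f : edge G) x, e != f ->
    segment (pos (tail e)) (pos (head e)) x ->
    segment (pos (tail f)) (pos (head f)) x ->
    exists v, [/\ incident e v, incident f v & x = pos v];
  not_isolated : forall v : vertex G,
    exists j : 'I_n, connect (@adjacent G) v (bdry G j);
  boundary_degree : forall j : 'I_n,
    (indeg (bdry G j) + outdeg (bdry G j) = 1)%N;
  src_incr : {homo @src G : r s / (r < s)%N};
  src_sources : forall j : 'I_n,
    (j \in codom (@src G)) = (outdeg (bdry G j) == 1%N);
  inner_degree : forall v : inner G,
    (indeg (intr v) + outdeg (intr v))%N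
      \in [:: 2%N; 3%N];
  white_indeg : forall v : inner G,
    white v -> indeg (intr v) = 1%N;
  black_outdeg : forall v : inner G,
    ~~ white v -> outdeg (intr v) = 1%N }.

Record plabic_network := PlabicNetwork {
  graph :> drawn_graph;
  graph_plabic : is_plabic graph;
  weight : edge graph -> R;
  weight_gt0 : forall e, 0 < weight e }.

Section Walks.
Variable G : drawn_graph.

Definition consecutive : rel (edge G) := fun e f => head e == tail f.

(* Directed path with first edge e ending at v. *)
Definition path_from_edge (e : edge G) (v : vertex G)
    (s : seq (edge G)) : bool :=
  if s is f :: s' then
    [&& f == e, path consecutive f s' & head (last f s') == v]
  else false.

(* Directed walk from u to v. *)
Definition walk_from_to (u v : vertex G) (s : seq (edge G)) : bool :=
  if s is f :: s' then
    [&& tail f == u, path consecutive f s' & head (last f s') == v]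
  else false.

(* Topological winding index of a walk s from b_i to b_j: the rotation number
   (total turning angle over 2 pi) of the closed curve obtained by following s
   and then going back counterclockwise along the boundary from b_j to b_i,
   minus 1, so that it vanishes on walks without self-intersections.  The
   boundary is counterclockwise tangent to ivl - ivr on the interval; the arc
   from b_j to b_i stays in the interval if i < j, and otherwise goes around the
   disk and turns by 2 pi.  The real number below is an integer; [Num.floor]
   merely casts it to int. *)
Definition wind_top (i j : 'I_n) (s : seq (edge G)) : int :=
  if s is e :: s' then
    let tau := ivl G - ivr G in
    let total :=
      \sum_(a <- pairmap (fun f g => turn (vec f) (vec g)) e s') a
      + turn (vec (last e s')) tau
      + (if (i < j)%N then 0 else 2 * pi)
      + turn tau (vec e) in
    Num.floor (total / (2 * pi) - 1)
  else 0.

(* Number of elements of I strictly between the pivot i_r and j. *)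
Definition sigma (r : 'I_k) (j : 'I_n) : nat :=
  #|[pred s : 'I_k | (minn (src G r) j < src G s < maxn (src G r) j)%N]|.

End Walks.

Definition boundary_measurement (N : plabic_network) : 'M[R]_(k, n) :=
  \matrix_(r < k, j < n)
    if j \in codom (@src N) then (src N r == j)%:R
    else (-1) ^+ sigma N r j *
         walk_sum (walk_from_to (bdry N (src N r)) (bdry N j))
                  (wind_top (src N r) j) (@weight N).

(* Points of the Grassmannian are classes of matrices modulo GL_k. *)
Definition represents (N : plabic_network) (A : 'M[R]_(k, n)) : Prop :=
  exists2 g : 'M[R]_k, g \in unitmx & A = g *m boundary_measurement N.

(* Generalized reduced row echelon form: the representative of [A] with
   identity submatrix in the columns I. *)
Definition grref (I : 'I_k -> 'I_n) (A : 'M[R]_(k, n)) : 'M[R]_(k, n) :=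
  invmx (colsub I A) *m A.

Section Gauge.
Variable G : drawn_graph.

Record gauge_direction (l : R * R) : Prop := GaugeDirection {
  gauge_inside : forall j : 'I_n,
    points_inside (disk G) (pos (bdry G j)) l;
  gauge_not_parallel : forall (e : edge G) (u v : inner G),
    tail e = intr u -> head e = intr v -> cross (vec e) l != 0;
  gauge_generic : forall (j : 'I_n) (v : inner G) (t : R), 0 <= t ->
    pos (intr v) != pos (bdry G j) + t *: l }.

Definition wind2 (l : R * R) (e f : edge G) : int :=
  let s := orient (vec e) (vec f) in
  if (s == orient (vec e) l) && (s == orient l (vec f)) then s else 0.

Definition wind (l : R * R) (s : seq (edge G)) : int :=
  if s is e :: s' then \sum_(z <- pairmap (wind2 l) e s') z else 0.

(* An edge meets a gauge ray in at most one point.  The starting point of the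
   ray (t = 0) can only be met by the edge at that source, and is not counted. *)
Definition int_edge (l : R * R) (e : edge G) : nat :=
  #|[pred r : 'I_k | `[< exists2 t : R, 0 < t &
       segment (pos (tail e)) (pos (head e))
         (pos (bdry G (src G r)) + t *: l) >]]|.

Definition int_path (l : R * R) (s : seq (edge G)) : nat :=
  (\sum_(e <- s) int_edge l e)%N.

(* Number of gauge rays passing the vertex v during the rotation from l to l'. *)
Definition cr (l l' : R * R) (v : vertex G) : nat :=
  #|[pred r : 'I_k | `[< exists t q : R, [/\ 0 <= t <= 1, 0 <= q
       & pos v = pos (bdry G (src G r)) + q *: rotation l l' t] >]]|.

Definition par (l l' : R * R) (e : edge G) : nat :=
  `[< exists t q : R, [/\ 0 <= t <= 1, 0 < q
       & vec e = q *: rotation l l' t] >].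

End Gauge.

Definition edge_vector (N : plabic_network) (l : R * R) (e : edge N) : 'rV[R]_n :=
  \row_(j < n) walk_sum (path_from_edge e (bdry N j))
                 (fun s => wind l s + (int_path l s)%:Z) (@weight N).

End Plabic.

(* Main.v *)
(* The sums are never evaluated: two walk series whose signs differ by a
   constant factor on each walk sum to values differing by that factor, so both
   claims are congruences mod 2 for a single walk.

   By the Pluecker relation, wind(e,f) changes with the gauge direction by
   par(e) + par(f).  The disk lies on one side of the interval, so a gauge ray
   is the part in the disk of a full line; int(e) is therefore the number of
   rays separating the endpoints of e, and it changes with the gauge direction
   by cr(tail e) + cr(head e).  Both changes telescope along a walk and vanish
   at its endpoint on the boundary, which gives (2).

   For (1), measure angles from -l: turn(e,f) = arg f - arg e + 2 pi wind(e,f).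
   Summing around the closed curve yields wind_top = wind up to a correction
   depending on the side of the gauge ray on which the first edge leaves and on
   the order of the endpoints.  The same correction separates int from sigma,
   because the rays separating the endpoints are those starting between them. *)
Require Import Defs.
From mathcomp Require Import all_boot all_order all_algebra.
From mathcomp Require mpoly.

Set Implicit Arguments.
Unset Strict Implicit.
Unset Printing Implicit Defensive.

(** * Scaling of walk series *)

Module WalkScale.
Import mpoly.
Import GRing.Theory.
Local Open Scope ring_scope.

(** The coefficient identity is linear in the series and the numerator jointly, so [a] multiplies
    the numerator and the denominator is kept. *)
Lemma walk_sums_to_scale (R : fieldType) (T : finType) (P P' : pred (seq T))
    (sg sg' : seq T -> int) (w : T -> R) (a x : R) : P' =1 P ->
  (forall s, P s -> (-1) ^ sg' s = a * (-1) ^ sg s) ->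
  WalkSeries.walk_sums_to P sg w x -> WalkSeries.walk_sums_to P' sg' w (a * x).
Proof.
move=> eP esg [p [q [pq nz ->]]]; exists (a *: p), q; split=> //.
- move=> m; rewrite mcoeffZ -pq big_distrr /=; apply: eq_bigr => h _.
  rewrite mulrCA; congr (_ * _).
  rewrite /WalkSeries.walk_coef big_distrr /=.
  apply: eq_big => s; first by rewrite eP.
  by rewrite eP => /andP[Ps _]; apply: esg.
- by rewrite mevalZ mulrA.
Qed.

End WalkScale.

From mathcomp Require Import boolp classical_sets reals topology normedtype.
From mathcomp Require Import trigo ring lra zify.
Import Order.TTheory GRing.Theory Num.Theory numFieldNormedType.Exports.
Local Open Scope ring_scope.

Local Notation head := Defs.head.

(** * Parities of integers and signs of walk sums *)

Definition oddz (z : int) : bool := odd `|z|%N.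

Lemma oddzD : {morph oddz : x y / x + y >-> x (+) y}.
Proof.
have oddzS (n : nat) : oddz n = odd n by [].
have oddzB (m n : nat) : oddz (m%:Z - n%:Z) = odd m (+) odd n.
  rewrite /oddz; case: (leqP m n) => [mn|/ltnW nm].
    by rewrite -opprB abszN subzn //= oddB // addbC.
  by rewrite subzn //= oddB.
move=> [m|m] [n|n]; rewrite ?NegzE /oddz ?abszN -/(oddz _).
- by rewrite -PoszD /oddz /= oddD.
- exact: oddzB.
- by rewrite addrC oddzB addbC.
- by rewrite -opprD -PoszD /oddz abszN /= !(addSn, addnS) /= oddD negbK; case: odd; case: odd.
Qed.

Lemma exprN1z (R : fieldType) (z : int) : (-1 : R) ^ z = (-1) ^+ oddz z.
Proof.
rewrite /oddz signr_odd; case: z => n; first by [].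
by rewrite NegzE abszN /= -exprnN -exprVn invrN1.
Qed.

Section WalkSum.
Variables (R : realType) (T : finType).
Implicit Types (P : pred (seq T)) (sg : seq T -> int) (w : T -> R).

Lemma walk_sum_sign P P' sg sg' w (b : bool) : P' =1 P ->
  (forall s, P s -> oddz (sg' s) = oddz (sg s) (+) b) ->
  walk_sum P' sg' w = (-1) ^+ b * walk_sum P sg w.
Proof.
move=> eP eb.
have esg s : P s -> (-1 : R) ^ sg' s = (-1) ^+ b * (-1) ^ sg s.
  by move=> /eb e; rewrite !exprN1z e signr_addb mulrC.
have esg' s : P' s -> (-1 : R) ^ sg s = (-1) ^+ b * (-1) ^ sg' s.
  by rewrite eP => /esg ->; rewrite signrMK.
rewrite {2}/walk_sum; case: xgetP => [x _ /= Sx|S0].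
  apply: xget_unique; first exact: WalkScale.walk_sums_to_scale Sx.
  by move=> y Sy; apply: WalkSeries.walk_sums_to_unique Sy _; apply: WalkScale.walk_sums_to_scale Sx.
(* If the series over [P] has no value, neither has the one over [P'], since applying the sign twice
   would produce one; both sums are then the default 0. *)
rewrite mulr0; apply: xgetPN => y /= Sy.
apply: (S0 ((-1) ^+ b * y)) => /=.
by apply: WalkScale.walk_sums_to_scale Sy => // s; rewrite eP.
Qed.

(** Over an empty set of walks the sign lemma applies with [b = true], so the sum equals its own
    negative. *)
Lemma walk_sum0 P sg w : P =1 xpred0 -> walk_sum P sg w = 0.
Proof.
move=> P0; have /eqP := @walk_sum_sign P P sg sg w true (frefl P)
  (fun s Ps => False_ind _ (notF (etrans (esym (P0 s)) Ps))).
by rewrite expr1 mulN1r -addr_eq0 -mulr2n mulrn_eq0 /= => /eqP.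
Qed.

End WalkSum.

(** * Cross products and cones in the plane *)

Section PlaneGeometry.
Variable R : realType.
Implicit Types u v w l d : R * R.

Lemma crossC u v : cross u v = - cross v u.
Proof. by rewrite /cross; ring. Qed.

Lemma crossDr u v w : cross u (v + w) = cross u v + cross u w.
Proof. by rewrite /cross /=; ring. Qed.

Lemma crossBr u v w : cross u (v - w) = cross u v - cross u w.
Proof. by rewrite /cross /=; ring. Qed.

Lemma crossZr (c : R) u v : cross u (c *: v) = c * cross u v.
Proof. by rewrite /cross /= /GRing.scale /=; ring. Qed.

Lemma crossZl (c : R) u v : cross (c *: u) v = c * cross u v.
Proof. by rewrite /cross /= /GRing.scale /=; ring. Qed.

Lemma crossvv u : cross u u = 0.
Proof. by rewrite /cross; ring. Qed.

Lemma dotZr (c : R) u v : dot u (c *: v) = c * dot u v.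
Proof. by rewrite /dot /= /GRing.scale /=; ring. Qed.

Lemma dotvv_ge0 u : 0 <= dot u u.
Proof. by rewrite addr_ge0 // -expr2 sqr_ge0. Qed.

Lemma cross_plucker u v w x :
  cross u v * cross w x = cross u w * cross v x - cross u x * cross v w.
Proof. by rewrite /cross; ring. Qed.

Lemma cross_eq0_scale u v : u != 0 -> cross u v = 0 -> exists c : R, v = c *: u.
Proof.
case: u v => [u1 u2] [v1 v2]; rewrite /cross /= => nz /eqP; rewrite subr_eq0 => /eqP e.
have [u10|u1n] := eqVneq u1 0.
  have u2n : u2 != 0 by apply: contra_neq nz => ->; rewrite u10.
  exists (v2 / u2); transitivity (v2 / u2 * u1, v2 / u2 * u2); last by [].
  by move: e; rewrite u10 mul0r mulr0 divfK // => /esym/eqP; rewrite mulf_eq0 (negPf u2n) => /eqP ->.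
exists (v1 / u1); transitivity (v1 / u1 * u1, v1 / u1 * u2); last by [].
by rewrite divfK // mulrAC [v1 * u2]mulrC -e mulrAC divff // mul1r.
Qed.

(* [l] lies in the open convex cone spanned by [u] and [v].  Both the parity of
   [wind2 l e f] and [par l l' e] are of this form, with the roles of gauge
   directions and edges exchanged. *)
Definition between u v l : bool :=
  [&& 0 < cross u v, 0 < cross u l & 0 < cross l v] ||
  [&& cross u v < 0, cross u l < 0 & cross l v < 0].

(** Here [a], [f], [p], [q], [r], [s] stand for the cross products of (u,v), (l,l'), (u,l), (u,l'),
    (v,l), (v,l'). A sign pattern violating the parity would give the two sides of the Pluecker
    relation opposite signs. *)
Lemma cross_sign_parity (a f p q r s : R) :
  p != 0 -> q != 0 -> r != 0 -> s != 0 -> a != 0 -> f != 0 ->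
  a * f = p * s - q * r ->
  ([&& 0 < a, 0 < p & 0 < - r] || [&& a < 0, p < 0 & - r < 0]) (+)
  ([&& 0 < a, 0 < q & 0 < - s] || [&& a < 0, q < 0 & - s < 0]) =
  ([&& 0 < f, 0 < - p & 0 < q] || [&& f < 0, - p < 0 & q < 0]) (+)
  ([&& 0 < f, 0 < - r & 0 < s] || [&& f < 0, - r < 0 & s < 0]).
Proof.
have mgt0 (x y : R) : 0 < x -> 0 < y -> 0 < x * y by exact: mulr_gt0.
have mlt0 (x y : R) : x < 0 -> y < 0 -> 0 < x * y by move=> x0; rewrite nmulr_rgt0.
have mgl (x y : R) : 0 < x -> y < 0 -> x * y < 0.
  by move=> x0; rewrite pmulr_rlt0.
have mlg (x y : R) : x < 0 -> 0 < y -> x * y < 0.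
  by move=> x0; rewrite nmulr_rlt0.
rewrite !oppr_gt0 !oppr_lt0.
case: (ltgtP p 0) => // p0 _; case: (ltgtP q 0) => // q0 _;
case: (ltgtP r 0) => // r0 _; case: (ltgtP s 0) => // s0 _;
case: (ltgtP a 0) => // a0 _; case: (ltgtP f 0) => // f0 _ //= e; exfalso;
do [have := mgt0 _ _ a0 f0|have := mlt0 _ _ a0 f0|have := mgl _ _ a0 f0|have := mlg _ _ a0 f0];
do [have := mgt0 _ _ p0 s0|have := mlt0 _ _ p0 s0|have := mgl _ _ p0 s0|have := mlg _ _ p0 s0];
do [have := mgt0 _ _ q0 r0|have := mlt0 _ _ q0 r0|have := mgl _ _ q0 r0|have := mlg _ _ q0 r0];
move: e; clear; lra.
Qed.

(* [u] and [v] are not opposite: the junk case for [wind2], which is then 0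
   for every gauge direction. *)
Definition nopp u v : Prop := cross u v = 0 -> 0 < dot u v.

(** This is the change of [wind2] mod 2 under a change of gauge. If one of the two pairs is
    parallel, [nopp] makes its members positive multiples of each other and both sides vanish;
    otherwise only signs matter. *)
Lemma between_parity u v l l' :
  cross u l != 0 -> cross u l' != 0 -> cross v l != 0 -> cross v l' != 0 ->
  nopp u v -> nopp l l' ->
  between u v l (+) between u v l' = between l l' u (+) between l l' v.
Proof.
move=> p q r s uv ll'.
have parl (x y : R * R) : cross x y = 0 -> nopp x y ->
    exists2 c, 0 < c & y = c *: x.
  move=> e /(_ e) xy; have x0 : x != 0.
    by apply: contraTneq xy => ->; rewrite /dot !mul0r addr0 ltxx.
  have [c ey] := cross_eq0_scale x0 e; exists c => //.
  move: xy; rewrite ey dotZr ltNge [0 < c]ltNge; apply: contraNN => c0.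
  by rewrite mulr_le0_ge0 ?dotvv_ge0.
rewrite /between (crossC l u) (crossC l v) (crossC l' v).
have [a0|a0] := eqVneq (cross u v) 0.
  have [c c0 ->] := parl _ _ a0 uv.
  by rewrite !crossZl crossZr crossvv mulr0 ltxx /= -mulrN !pmulr_rgt0 ?pmulr_rlt0 // addbb.
have [f0|f0] := eqVneq (cross l l') 0.
  have [c c0 ->] := parl _ _ f0 ll'.
  by rewrite !crossZr crossvv mulr0 ltxx /= -mulrN !pmulr_rgt0 ?pmulr_rlt0 // addbb.
by apply: cross_sign_parity => //; apply: cross_plucker.
Qed.

End PlaneGeometry.

(** * Turning angles and winding *)

Section Turning.
Variable R : realType.
Implicit Types (u v w l m d : R * R) (x y : R).

(** A form of [wind2] for arbitrary vectors: the boundary direction closing up a walk is not an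
    edge. *)
Definition windv l u v : int :=
  let s := orient u v in
  if (s == orient u l) && (s == orient l v) then s else 0.

Lemma oddz_windv l u v : oddz (windv l u v) = between u v l.
Proof.
rewrite /windv /orient /between.
by case: (sgzP (cross u v)) => a; case: (sgzP (cross u l)) => b;
   case: (sgzP (cross l v)) => c; rewrite ?andbF.
Qed.

Lemma cross_rotationl l l' t : cross l (rotation l l' t) = t * cross l l'.
Proof. by rewrite /cross /rotation /= /GRing.scale /=; ring. Qed.

Lemma cross_rotationr l l' t : cross (rotation l l' t) l' = (1 - t) * cross l l'.
Proof. by rewrite /cross /rotation /= /GRing.scale /=; ring. Qed.

Lemma in_rotationP l l' u : cross l u != 0 -> cross u l' != 0 ->
  (exists t q : R, [/\ 0 <= t <= 1, 0 < q & u = q *: rotation l l' t]) <->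
  between l l' u.
Proof.
move=> lu ul'; split.
  case=> t [q [/andP[t0 t1] q0 eu]].
  move: lu ul'; rewrite /between eu crossZr cross_rotationl crossZl cross_rotationr.
  rewrite !(pmulr_rgt0 _ q0) !(pmulr_rlt0 _ q0) !mulf_eq0 !negb_or (gt_eqF q0) /=.
  move=> /andP[tn D] /andP[tn' _].
  have t_gt0 : 0 < t by rewrite lt0r tn.
  have t_lt1 : 0 < 1 - t by rewrite lt0r tn' subr_ge0.
  rewrite !(pmulr_rgt0 _ t_gt0) !(pmulr_rgt0 _ t_lt1).
  by rewrite !(pmulr_rlt0 _ t_gt0) !(pmulr_rlt0 _ t_lt1) !andbb; case: ltgtP D.
(* By Cramer's rule [u = a *: l + b *: l']; dividing by [a + b] gives the rotation parameter. *)
move=> btw; pose D := cross l l'; pose a := cross u l' / D; pose b := cross l u / D.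
have D0 : D != 0.
  by case/orP: btw => /and3P[D0 _ _]; rewrite /D ?(gt_eqF D0) ?(lt_eqF D0).
have [a0 b0] : 0 < a /\ 0 < b.
  case/orP: btw => /and3P[D1 lu1 ul1]; first by rewrite !divr_gt0.
  have Vlt (x : R) : x < 0 -> 0 < x / D by move=> x0; rewrite nmulr_rgt0 // invr_lt0.
  by split; apply: Vlt.
have ab : 0 < a + b by rewrite addr_gt0.
exists (b / (a + b)), (a + b); split=> //.
  apply/andP; split; first by apply: divr_ge0; apply: ltW.
  by rewrite (ler_pdivrMr _ _ ab) mul1r lerDr ltW.
have [e1 e2] : u.1 = a * l.1 + b * l'.1 /\ u.2 = a * l.2 + b * l'.2.
  have aD : a * D = cross u l' by rewrite divfK.
  have bD : b * D = cross l u by rewrite divfK.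
  clearbody a b.
  by split; apply: (mulIf D0); rewrite mulrDl ![_ * _ * D]mulrAC aD bD /D /cross; ring.
have ab0 : a + b != 0 by rewrite gt_eqF.
move: a b e1 e2 ab0 {ab a0 b0} => a b e1 e2 ab0; rewrite [LHS]surjective_pairing e1 e2.
transitivity ((a + b) * ((1 - b / (a + b)) * l.1 + b / (a + b) * l'.1),
              (a + b) * ((1 - b / (a + b)) * l.2 + b / (a + b) * l'.2)); last by [].
by congr pair; field.
Qed.

Lemma enorm_sqr u : enorm u ^+ 2 = dot u u.
Proof. by rewrite sqr_sqrtr ?dotvv_ge0. Qed.

Lemma enorm_gt0 u : u != 0 -> 0 < enorm u.
Proof.
case: u => u1 u2 nz; rewrite sqrtr_gt0 lt0r dotvv_ge0 andbT /dot /= -!expr2.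
rewrite paddr_eq0 ?sqr_ge0 // !sqrf_eq0; apply: contraNN nz => /andP[/eqP-> /eqP->].
by [].
Qed.

Lemma enormZ (c : R) u : enorm (c *: u) = `|c| * enorm u.
Proof.
rewrite /enorm -sqrtr_sqr -sqrtrM ?sqr_ge0 //; congr Num.sqrt.
by rewrite /dot /= /GRing.scale /=; ring.
Qed.

Lemma turn_parallel (c : R) u : u != 0 -> 0 < c -> turn u (c *: u) = 0.
Proof.
move=> u0 c0; rewrite /turn crossZr crossvv mulr0 ltxx dotZr -enorm_sqr enormZ.
rewrite gtr0_norm // [enorm u * (_ * _)]mulrCA -expr2 divff ?acos1 //.
by rewrite mulf_neq0 ?(gt_eqF c0) // gt_eqF // exprn_gt0 // enorm_gt0.
Qed.

Lemma turn_opposite (c : R) u : u != 0 -> c < 0 -> turn u (c *: u) = pi.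
Proof.
move=> u0 c0; rewrite /turn crossZr crossvv mulr0 ltxx dotZr -enorm_sqr enormZ.
rewrite ltr0_norm // [enorm u * (_ * _)]mulrCA -expr2 mulNr invrN mulrN.
rewrite divff ?acosN1 // mulf_neq0 ?(lt_eqF c0) //.
by rewrite gt_eqF // exprn_gt0 // enorm_gt0.
Qed.

Lemma lagrange_id u v :
  dot u v ^+ 2 + cross u v ^+ 2 = (enorm u * enorm v) ^+ 2.
Proof. by rewrite exprMn !enorm_sqr /dot /cross; ring. Qed.

Lemma turn_spec u v : u != 0 -> v != 0 ->
  [/\ - pi <= turn u v <= pi,
      enorm u * enorm v * cos (turn u v) = dot u v
    & enorm u * enorm v * sin (turn u v) = cross u v].
Proof.
move=> u0 v0; rewrite /turn; set N := enorm u * enorm v.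
have N0 : 0 < N by rewrite mulr_gt0 ?enorm_gt0.
have Nn : N != 0 by rewrite gt_eqF.
set c := dot u v / N; set s := cross u v / N.
have cs : 1 - c ^+ 2 = s ^+ 2.
  by rewrite /c /s !expr_div_n; apply: (mulIf (expf_neq0 2 Nn));
     rewrite mulrBl !divfK ?expf_neq0 // mul1r -lagrange_id; ring.
have c1 : -1 <= c <= 1.
  by rewrite -ler_norml -(ler_pXn2r (ltn0Sn 1)) ?nnegrE // expr1n real_normK ?num_real // -subr_ge0 cs sqr_ge0.
have cosa : cos (acos c) = c by rewrite acosK // in_itv.
have sina : sin (acos c) = `|s| by rewrite sin_acos // cs sqrtr_sqr.
have a0 := acos_ge0 c1; have api := acos_lepi c1.
have Ncross : N * s = cross u v by rewrite mulrC divfK.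
case: ifPn => [cr|]; rewrite -?leNgt ?cosN ?sinN cosa sina.
  have sneg : s < 0 by rewrite pmulr_llt0 ?invr_gt0.
  rewrite ltr0_norm // opprK Ncross mulrC divfK //; split=> //.
  by apply/andP; split; lra.
move=> cr; have spos : 0 <= s by rewrite pmulr_lge0 ?invr_gt0.
rewrite ger0_norm // Ncross mulrC divfK //; split=> //.
by apply/andP; split; lra.
Qed.

Lemma turn_lt_pi u v : u != 0 -> v != 0 -> nopp u v -> - pi < turn u v < pi.
Proof.
move=> u0 v0 uv; have [/andP[h1 h2] ec es] := turn_spec u0 v0.
have N0 : 0 < enorm u * enorm v by rewrite mulr_gt0 ?enorm_gt0.
have key (x : R) : (x = pi \/ x = - pi) -> turn u v != x.
  move=> ex; apply/eqP => et; move: ec es.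
  have -> : cos (turn u v) = -1 by rewrite et; case: ex => ->; rewrite ?cosN cospi.
  have -> : sin (turn u v) = 0.
    by rewrite et; case: ex => ->; rewrite ?sinN sinpi ?oppr0.
  rewrite mulr0 => ec /esym/uv; rewrite -ec mulrN1 oppr_gt0 => N1.
  by have := lt_trans N0 N1; rewrite ltxx.
by rewrite !lt_neqAle h1 h2 eq_sym !key; auto.
Qed.

Lemma sin_sign x : - pi < x < pi -> (0 < sin x) = (0 < x) /\ (sin x < 0) = (x < 0).
Proof.
move=> /andP[x1 x2]; have [x0|x0|->] := ltgtP x 0.
- have : 0 < sin (- x) by rewrite sin_gt0_pi // oppr_gt0 x0 ltrNl x1.
  by rewrite sinN oppr_gt0 => h; rewrite h; split=> //; apply/negbTE; rewrite -leNgt ltW.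
- have h : 0 < sin x by rewrite sin_gt0_pi // x0 x2.
  by rewrite h; split=> //; apply/negbTE; rewrite -leNgt ltW.
- by rewrite sin0 ltxx.
Qed.

Lemma turn_sign u v : u != 0 -> v != 0 -> nopp u v ->
  (0 < turn u v) = (0 < cross u v) /\ (turn u v < 0) = (cross u v < 0).
Proof.
move=> u0 v0 uv; have [h1 h2] := sin_sign (turn_lt_pi u0 v0 uv).
have [_ _ <-] := turn_spec u0 v0.
have N0 : 0 < enorm u * enorm v by rewrite mulr_gt0 ?enorm_gt0.
by rewrite pmulr_rgt0 // pmulr_rlt0 // h1 h2.
Qed.

(** By the double angle formula the half angle has sine 0, and it lies strictly between -pi and
    pi. *)
Lemma cos_eq1 x : - (2 * pi) < x < 2 * pi -> cos x = 1 -> x = 0.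
Proof.
move=> /andP[x1 x2]; have -> : x = (x / 2) *+ 2 by rewrite mulr2n -splitr.
set y := x / 2; rewrite cos_mulr2n cos2sin2 => e.
have sy : sin y = 0 by apply/eqP; rewrite -sqrf_eq0; apply/eqP; move: e; lra.
have yb : - pi < y < pi by rewrite /y; apply/andP; split; lra.
have [] := sin_sign yb; rewrite sy ltxx => /esym/negbT; rewrite -leNgt => h1.
move=> /esym/negbT; rewrite -leNgt => h2.
have -> : y = 0 by apply/eqP; rewrite eq_le h1 h2.
exact: mul0rn.
Qed.

Lemma nopp_cross u v : cross u v != 0 -> nopp u v.
Proof. by move=> /eqP uv /uv. Qed.

(** Angles measured from [- l] avoid the cut along [l], so they lie strictly between -pi and pi.
    Without the winding term the two sides have the same sine and cosine, hence differ by a multiple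
    of 2 pi; the signs of the angles decide which one. *)
Lemma turn_wind l u v : cross u l != 0 -> cross v l != 0 -> nopp u v ->
  turn u v = turn (- l) v - turn (- l) u + 2 * pi * (windv l u v)%:~R.
Proof.
move=> ul vl uv.
have nz (x y : R * R) : cross x y != 0 -> x != 0 /\ - y != 0.
  by move=> h; split; [apply: contraNneq h => ->|rewrite oppr_eq0; apply: contraNneq h => ->];
     rewrite /cross /= ?mul0r ?mulr0 subr0.
have [u0 m0] := nz _ _ ul; have [v0 _] := nz _ _ vl.
have mE (x : R * R) : cross (- l) x = cross x l by rewrite /cross /=; ring.
have mu : cross (- l) u != 0 by rewrite mE.
have mv : cross (- l) v != 0 by rewrite mE.
have [_ cu su] := turn_spec m0 u0; have [_ cv sv] := turn_spec m0 v0.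
have [_ cw sw] := turn_spec u0 v0.
have Bu := turn_lt_pi m0 u0 (nopp_cross mu).
have Bv := turn_lt_pi m0 v0 (nopp_cross mv).
have Bw := turn_lt_pi u0 v0 uv.
have [pu nu] := turn_sign m0 u0 (nopp_cross mu).
have [pv nv] := turn_sign m0 v0 (nopp_cross mv).
have [pw nw] := turn_sign u0 v0 uv.
rewrite mE in pu nu; rewrite mE in pv nv.
have um0 := enorm_gt0 m0; have uu0 := enorm_gt0 u0; have uv0 := enorm_gt0 v0.
set a := turn (- l) u in Bu pu nu cu su *.
set b := turn (- l) v in Bv pv nv cv sv *.
set c := turn u v in Bw pw nw cw sw *.
have K0 : enorm (- l) ^+ 2 * (enorm u * enorm v) != 0.
  by rewrite gt_eqF // !mulr_gt0 // exprn_gt0.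
have ecos : cos (b - a) = cos c.
  apply: (mulfI K0); transitivity (enorm (- l) ^+ 2 * dot u v); last by rewrite -cw; ring.
  rewrite cosB enorm_sqr; transitivity (dot (- l) v * dot (- l) u + cross (- l) v * cross (- l) u).
    by rewrite -cu -su -cv -sv -enorm_sqr; ring.
  by rewrite /dot /cross /=; ring.
have esin : sin (b - a) = sin c.
  apply: (mulfI K0); transitivity (enorm (- l) ^+ 2 * cross u v); last by rewrite -sw; ring.
  rewrite sinB enorm_sqr; transitivity (cross (- l) v * dot (- l) u - dot (- l) v * cross (- l) u).
    by rewrite -cu -su -cv -sv -enorm_sqr; ring.
  by rewrite /dot /cross /=; ring.
have e1 : cos (c - (b - a)) = 1.
  by rewrite cosB ecos esin -!expr2 cos2Dsin2.
have e2 : cos (c - (b - a) - pi *+ 2) = 1.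
  by rewrite -e1 -[in RHS](subrK (pi *+ 2) (c - (b - a))) cosD2pi.
have e3 : cos (c - (b - a) + pi *+ 2) = 1 by rewrite cosD2pi.
have pi0 := pi_gt0 R.
move/andP: Bu => [Bu1 Bu2]; move/andP: Bv => [Bv1 Bv2]; move/andP: Bw => [Bw1 Bw2].
(* Since [cross (- l) u = cross u l], the tests in [windv] are sign tests on the angles; the two
   nonzero cases are the two ways of crossing the cut. *)
have wE : windv l u v = if [&& 0 < c, 0 < a & b < 0] then 1
                        else if [&& c < 0, a < 0 & 0 < b] then -1 else 0.
  rewrite pu nu pv nv pw nw /windv /orient (crossC l v) sgzN.
  by case: (sgzP (cross u v)); case: (sgzP (cross u l)) ul;
     case: (sgzP (cross v l)) vl.
rewrite {}wE; case: ifPn => [/and3P[c0 a0 b0]|n1].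
  have := cos_eq1 _ e2; lra.
case: ifPn => [/and3P[c0 a0 b0]|n2].
  have := cos_eq1 _ e3; lra.
have := cos_eq1 _ e1; rewrite mulr0.
(* Each of [c], [a], [- b] has absolute value below pi; a failed sign test drops one of them from
   the bound on their sum. *)
suff : - (2 * pi) < c - (b - a) < 2 * pi by move=> -> /(_ isT); lra.
move: n1 n2; rewrite !negb_and -!leNgt => n1 n2; apply/andP; split.
  by case/or3P: n2 => h; lra.
by case/or3P: n1 => h; lra.
Qed.

End Turning.

Lemma odd_card (T : finType) (P : pred T) : odd #|P| = \big[addb/false]_r P r.
Proof.
rewrite -sum1_card (big_morph odd oddD (erefl _)) [LHS]big_mkcond /=.
by apply: eq_bigr => r _; rewrite unfold_in; case: (P r).
Qed.

(** * The graph drawn in the disk *)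

Section PlabicGeometry.
Variables (R : realType) (k n : nat) (G : drawn_graph R k n).
Hypothesis Gp : is_plabic G.
Implicit Types (e f : edge G) (u v : vertex G) (s : seq (edge G)) (r : 'I_k).
Implicit Types (i j : 'I_n) (l : R * R).

Let d := ivr G - ivl G.
(** A positive multiple of the signed distance to the line carrying the boundary vertices; it is
    negative inside the disk. *)
Let ht v := cross d (pos v - ivl G).

Definition is_bdry v : bool := if v is inl _ then true else false.

Lemma ht_inner v : ~~ is_bdry v -> ht v < 0.
Proof. by case: v => // v _; apply: interval_clockwise => //; apply: inner_pos. Qed.

Lemma ht_bdry v : is_bdry v -> ht v = 0.
Proof.
case: v => // j _; rewrite /ht; have [t [_ _ ->]] := boundary_pos Gp.
by rewrite addrC addKr crossZr crossvv mulr0.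
Qed.

Lemma ht_le0 v : ht v <= 0.
Proof. by case: (boolP (is_bdry v)) => [/ht_bdry->|/ht_inner/ltW]. Qed.

Lemma htB u v : cross d (pos v - pos u) = ht v - ht u.
Proof. by rewrite /ht -crossBr; congr cross; rewrite opprB addrA subrK. Qed.

Lemma ht_vec e : cross d (vec e) = ht (head e) - ht (tail e).
Proof. exact: htB. Qed.

(** A point of the ray just after its start is interior to the disk, hence on the negative side of
    the line. *)
Lemma gauge_below l j : gauge_direction G l -> cross d l < 0.
Proof.
move=> gl; have [t [ti t0]] := @filter_ex _ _ _ _
  (filterI (gauge_inside gl j) (nbhs_right_gt (0 : R))).
have := interval_clockwise Gp ti; rewrite -/d addrAC crossDr.
by rewrite -/(ht _) ht_bdry // add0r crossZr pmulr_rlt0.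
Qed.

Lemma vec_neq0 e : vec e != 0.
Proof. by rewrite subr_eq0 (inj_eq (pos_inj Gp)) eq_sym no_loop. Qed.

Lemma dir_neq0 l : cross d l < 0 -> l != 0.
Proof. by apply: contraTneq => ->; rewrite /cross !mulr0 subr0 ltxx. Qed.

Lemma cross_dir_ray l (x : R * R) : cross d l < 0 -> cross l x = 0 -> cross d x < 0 ->
  exists2 t : R, 0 < t & x = t *: l.
Proof.
move=> dl lx dx; have [t ex] := cross_eq0_scale (dir_neq0 dl) lx.
by exists t => //; move: dx; rewrite ex crossZr nmulr_llt0.
Qed.

Lemma nopp_dir l l' : cross d l < 0 -> cross d l' < 0 -> nopp l l'.
Proof.
move=> dl dl' /(cross_dir_ray dl) /(_ dl') [t t0 ->]; rewrite dotZr.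
by rewrite mulr_gt0 // lt0r dotvv_ge0 -enorm_sqr expf_eq0 /= gt_eqF // enorm_gt0 ?dir_neq0.
Qed.

Lemma bdry_diff : exists c : 'I_n -> 'I_n -> R,
  [/\ forall i j, pos (bdry G j) - pos (bdry G i) = c i j *: d,
      forall i j, (0 < c i j) = (i < j)%N & forall i j, (c i j < 0) = (j < i)%N].
Proof.
have [t [t_incr _ pt]] := boundary_pos Gp; exists (fun i j => t j - t i).
have tE i j : (t i < t j) = (i < j)%N.
  case: (ltngtP i j) => [/t_incr->//|/t_incr ji|/val_inj->]; last by rewrite ltxx.
  by apply/negbTE; rewrite -leNgt ltW.
split=> i j; last 2 first; rewrite ?subr_gt0 ?subr_lt0 ?tE //.
by rewrite !pt opprD addrACA subrr add0r -scalerBl.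
Qed.

(** Edges between inner vertices are covered by the definition. An edge joining a boundary vertex to
    an inner one would put the latter on a ray, and an edge between boundary vertices has the
    direction of the interval, which [l] is not parallel to. *)
Lemma cross_vec_gauge l e : gauge_direction G l -> cross l (vec e) != 0.
Proof.
move=> gl; have [j _] := not_isolated Gp (tail e); have dl := gauge_below j gl.
rewrite crossC oppr_eq0; case et : (tail e) => [i|u]; case eh : (head e) => [j'|v].
- have [c [cE _ _]] := bdry_diff; have ve : vec e = c i j' *: d by rewrite -cE /vec et eh.
  rewrite ve crossZl mulf_neq0 ?(lt_eqF dl) //; apply: contraNneq (vec_neq0 e) => c0.
  by rewrite ve c0 scale0r.
- apply/eqP; rewrite crossC => /eqP; rewrite oppr_eq0 => /eqP le.
  have : cross d (vec e) < 0 by rewrite ht_vec eh et [ht (inl _)]ht_bdry // subr0 ht_inner.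
  case/(cross_dir_ray dl le) => t t0 et'.
  move: (gauge_generic gl i v (ltW t0)); rewrite -et' /vec et eh /=.
  by rewrite addrC subrK eqxx.
- apply/eqP; rewrite crossC => /eqP; rewrite oppr_eq0 => /eqP le.
  have : cross d (- vec e) < 0.
    by rewrite -scaleN1r crossZr mulN1r ht_vec eh et [ht (inl _)]ht_bdry // sub0r opprK ht_inner.
  have le' : cross l (- vec e) = 0 by rewrite -scaleN1r crossZr le mulr0.
  case/(cross_dir_ray dl le') => t t0 et'.
  move: (gauge_generic gl j' u (ltW t0)); rewrite -et' /vec et eh /= opprB.
  by rewrite addrC subrK eqxx.
- exact: (gauge_not_parallel gl et eh).
Qed.

Lemma bdry_head_tail e f j : head e = bdry G j -> tail f = bdry G j -> False.
Proof.
move=> he tf; have := boundary_degree Gp j.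
have : (0 < indeg (bdry G j))%N by apply/card_gt0P; exists e; rewrite inE he.
have : (0 < outdeg (bdry G j))%N by apply/card_gt0P; exists f; rewrite inE tf.
by case: indeg => // a; case: outdeg => // b; rewrite addnS.
Qed.

Lemma consecutive_inner e f : consecutive e f -> ~~ is_bdry (tail f).
Proof.
by move=> /eqP ef; case tf: (tail f) => [j|//]; case: (@bdry_head_tail e f j);
  rewrite ?ef.
Qed.

Lemma src_edge r : exists2 e, tail e = bdry G (src G r)
  & forall f, tail f = bdry G (src G r) -> f = e.
Proof.
have := src_sources Gp (src G r); rewrite codom_f => /esym/eqP/eqP/card1P [e eE]; exists e.
  by have := eE e; rewrite !inE eqxx => /eqP.
by move=> f tf; have := eE f; rewrite !inE tf eqxx => /esym/eqP.
Qed.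

(* If the edges [e] and [f] had opposite directions, they would overlap near
   the vertex between them, which planarity forbids. *)
Lemma nopp_consecutive e f : consecutive e f -> nopp (vec e) (vec f).
Proof.
move=> /eqP ef par0; have [c fc] := cross_eq0_scale (vec_neq0 e) par0.
have ve0 := enorm_gt0 (vec_neq0 e).
rewrite fc dotZr mulr_gt0 // -?enorm_sqr ?exprn_gt0 //.
rewrite ltNge; apply/negP => c0; have {c0} cn : c < 0.
  by rewrite lt_neqAle c0 andbT; apply: contraNneq (vec_neq0 f) => c1; rewrite fc c1 scale0r.
have nef : e != f by apply: contraTneq (no_loop Gp e) => e0; rewrite negbK ef -e0.
(* The common point lies at parameter [1 - a] on [e] and [b] on [f]; halving the smaller of [- c]
   and 1 keeps it on both segments and off the ends of [e]. *)
pose a : R := (if - c < 1 then - c else 1) / 2; pose b : R := a / - c.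
have aP : 0 < a < 1 /\ 0 <= b <= 1.
  rewrite /b ler_pdivlMr ?ler_pdivrMr ?oppr_gt0 // mul0r mul1r /a.
  by case: (ltP (- c) 1) => h; split; apply/andP; split; lra.
have pf : pos (head f) - pos (tail f) = c *: vec e by rewrite -fc.
pose x := pos (tail e) + (1 - a) *: vec e.
have xe : segment (pos (tail e)) (pos (head e)) x.
  by exists (1 - a) => //; apply/andP; split; lra.
have xf : segment (pos (tail f)) (pos (head f)) x.
  exists b; first by lra.
  have bc : b * c = - a by rewrite /b invrN mulrN mulNr divfK ?lt_eqF.
  rewrite pf scalerA bc.
  by rewrite -ef /x scalerBl scale1r addrA [pos (tail e) + _]addrC subrK scaleNr.
have [v [ve _ xv]] := planar Gp nef xe xf.
have {xf xv}ev : pos v = pos (tail e) + (1 - a) *: vec e by [].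
case/orP: ve => /eqP ve; move/eqP: ev; rewrite -ve.
  rewrite -subr_eq0 opprD addrA subrr sub0r oppr_eq0 scaler_eq0 (negPf (vec_neq0 e)) orbF.
  by rewrite gt_eqF //; lra.
rewrite -subr_eq0 opprD addrA -/(vec e) scalerBl scale1r subKr scaler_eq0.
by rewrite (negPf (vec_neq0 e)) orbF gt_eqF //; lra.
Qed.

(** * Winding under a change of gauge direction *)

Section WindParity.
Variables l l' : R * R.
Hypotheses (gl : gauge_direction G l) (gl' : gauge_direction G l').

Lemma wind_cons (g : R * R) e f s :
  wind g [:: e, f & s] = windv g (vec e) (vec f) + wind g (f :: s).
Proof. by rewrite /wind /= big_cons. Qed.

Lemma wind_parity e s : path (@consecutive _ _ _ G) e s ->
  oddz (wind l (e :: s)) (+) oddz (wind l' (e :: s)) =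
  between l l' (vec e) (+) between l l' (vec (last e s)).
Proof.
have [j _] := not_isolated Gp (tail e).
have cr (g : R * R) (f : edge G) : gauge_direction G g -> cross (vec f) g != 0.
  by move=> gg; rewrite crossC oppr_eq0; apply: cross_vec_gauge.
elim: s e => [|f s IH] e; first by rewrite /wind /= !big_nil !addbb.
move=> /andP[ef pth]; rewrite !wind_cons !oddzD !oddz_windv [last _ _]/=.
have := between_parity (cr _ e gl) (cr _ e gl') (cr _ f gl) (cr _ f gl')
  (nopp_consecutive ef) (nopp_dir (gauge_below j gl) (gauge_below j gl')).
move: (IH f pth).
do 2!case: (oddz _); do 2!case: (between (vec _) _ _); do 3!case: (between l l' _); by [].
Qed.

End WindParity.

(** * Sides of the gauge rays and intersection parities *)

Lemma between_below l l' (x : R * R) : cross d l < 0 -> cross d l' < 0 ->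
  between l l' x -> cross d x < 0.
Proof.
move=> dl dl'; have e := cross_plucker d x l l'.
case/orP => /and3P[h1 h2 h3]; rewrite ltNge; apply/negP => h; move: e; apply/eqP.
  rewrite gt_eqF // (lt_le_trans _ (mulr_ge0 h (ltW h1))) //.
  by rewrite subr_lt0 (lt_trans (_ : _ < 0)) ?nmulr_rlt0 ?nmulr_rgt0 // crossC ?oppr_lt0 ?oppr_gt0.
rewrite lt_eqF // (le_lt_trans (mulr_ge0_le0 h (ltW h1))) //.
by rewrite subr_gt0 (lt_trans (_ : _ < 0)) ?nmulr_rlt0 ?nmulr_rgt0 // crossC ?oppr_lt0 ?oppr_gt0.
Qed.

(** The side is taken with respect to the full line through the source; points of that line with
    negative [ht] lie on the ray. *)
Definition right_of l r v : bool := cross l (pos v - pos (bdry G (src G r))) < 0.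

Lemma right_of_neq0 l r v : gauge_direction G l -> v != bdry G (src G r) ->
  cross l (pos v - pos (bdry G (src G r))) != 0.
Proof.
move=> gl vr; have dl := gauge_below (src G r) gl.
case: v vr => [j|v] jr.
  have [c [cE _ _]] := bdry_diff; rewrite -[inl j]/(bdry G j) cE crossZr crossC mulrN.
  rewrite oppr_eq0 mulf_neq0 ?(lt_eqF dl) //; apply: contraNneq jr => c0.
  have : pos (bdry G j) - pos (bdry G (src G r)) = 0 by rewrite cE c0 scale0r.
  by move/eqP; rewrite subr_eq0 (inj_eq (pos_inj Gp)).
apply/eqP => le.
have dw : cross d (pos (inr v) - pos (bdry G (src G r))) < 0.
  by rewrite htB [ht (bdry _ _)]ht_bdry // subr0 ht_inner.
case/(cross_dir_ray dl le): dw => t t0 ev.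
by move: (gauge_generic gl (src G r) v (ltW t0)); rewrite -ev addrC subrK eqxx.
Qed.

(** The answer does not involve [l], so the boundary end of a walk drops out when two gauges are
    compared. *)
Lemma right_of_bdry l r j : gauge_direction G l ->
  right_of l r (bdry G j) = (j < src G r)%N.
Proof.
move=> gl; have dl := gauge_below j gl.
have [c [cE _ cP]] := bdry_diff; rewrite /right_of cE.
by rewrite crossZr crossC mulrN -mulNr nmulr_llt0 // oppr_gt0 cP.
Qed.

(** The interior of the edge lies strictly below the interval, where line and ray agree, so the ray
    is met when the ends are on different sides. An edge leaving the source of the ray meets it only
    at the uncounted start; its tail is not [right_of], and the last term cancels the side of its
    head. *)
Lemma crossing_parity l e r : gauge_direction G l ->
  ~~ (is_bdry (tail e) && is_bdry (head e)) ->
  `[< exists2 t : R, 0 < t & segment (pos (tail e)) (pos (head e))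
         (pos (bdry G (src G r)) + t *: l) >] =
  (right_of l r (tail e) (+) right_of l r (head e)) (+)
  ((tail e == bdry G (src G r)) && (cross l (vec e) < 0)).
Proof.
move=> gl nb; have dl := gauge_below (src G r) gl.
set b := pos (bdry G (src G r)).
pose X := cross l (pos (tail e) - b); pose Y := cross l (pos (head e) - b).
have dE v : cross d (pos v - b) = ht v.
  by rewrite htB [ht (bdry _ _)]ht_bdry // subr0.
have segE (s : R) : pos (tail e) + s *: (pos (head e) - pos (tail e)) - b =
    (1 - s) *: (pos (tail e) - b) + s *: (pos (head e) - b).
  rewrite scalerBl scale1r -[RHS]addrA -scalerN -scalerDr opprB.
  by rewrite [b - _ + _]addrC addrA subrK addrAC.
have Y0 : Y != 0.
  apply: right_of_neq0 => //; apply/eqP => hr.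
  by have [f tf _] := src_edge r; apply: (bdry_head_tail hr tf).
have hneg (s : R) : 0 < s < 1 -> (1 - s) * ht (tail e) + s * ht (head e) < 0.
  move=> /andP[s0 s1]; have hT := ht_le0 (tail e); have hH := ht_le0 (head e).
  have s1' : 0 < 1 - s by rewrite subr_gt0.
  move: nb; rewrite negb_and => /orP[] /ht_inner h.
    by rewrite -[ltRHS]addr0 ltr_leD ?pmulr_rlt0 ?pmulr_rle0.
  by rewrite -[ltRHS]addr0 ler_ltD ?pmulr_rlt0 ?pmulr_rle0.
have crossE : (exists2 t : R, 0 < t &
    segment (pos (tail e)) (pos (head e)) (b + t *: l)) -> exists s : R,
    [/\ 0 <= s <= 1, (1 - s) * X + s * Y = 0 & (1 - s) * ht (tail e) + s * ht (head e) < 0].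
  case=> t t0 [s s01 es]; exists s; split=> //.
    by rewrite -!crossZr -crossDr -segE -es addrC addKr crossZr crossvv mulr0.
  by rewrite -!dE -!crossZr -crossDr -segE -es addrC addKr crossZr pmulr_rlt0.
have crossEV (s : R) : 0 < s < 1 -> (1 - s) * X + s * Y = 0 ->
    exists2 t : R, 0 < t & segment (pos (tail e)) (pos (head e)) (b + t *: l).
  move=> s01 e0; have := hneg _ s01.
  have : cross l (pos (tail e) + s *: (pos (head e) - pos (tail e)) - b) = 0.
    by rewrite segE crossDr !crossZr.
  move=> le; rewrite -!dE -!crossZr -crossDr -segE => /(cross_dir_ray dl le) [t t0 et].
  exists t => //; exists s; first by case/andP: s01 => /ltW-> /ltW->.
  by rewrite -et addrC subrK.
rewrite /right_of -/X -/Y; case: (eqVneq (tail e) (bdry G (src G r))) => [te|tn] /=.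
  have X0 : X = 0 by rewrite /X te subrr /cross !mulr0 subr0.
  have -> : vec e = pos (head e) - b by rewrite /vec te.
  rewrite -/Y X0 ltxx addbb; apply/asboolP => /crossE [s [_ e0 hs]].
  (* The line meets the edge only at its tail, whose height is 0, whereas [t > 0] demands a negative
     height. *)
  have s0 : s = 0 by apply/eqP; move/eqP: e0; rewrite X0 mulr0 add0r mulf_eq0 (negPf Y0) orbF.
  by move: hs; rewrite s0 mul0r addr0 subr0 mul1r te ht_bdry // ltxx.
have X0 : X != 0 by apply: right_of_neq0.
rewrite addbF; apply/asboolP/idP => [/crossE [s [/andP[s0 s1] e0 _]]|].
  case: (ltgtP X 0) X0 => // x0 _; case: (ltgtP Y 0) Y0 => // y0 _; exfalso; nra.
move=> XY; have D0 : X - Y != 0.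
  rewrite subr_eq0; apply: contraTneq XY => ->; by rewrite addbb.
(* The zero of the affine function with value [X] at the tail and [Y] at the head. *)
apply: (crossEV (X / (X - Y))); last by field.
case: (ltgtP X 0) X0 XY => // x0 _; case: (ltgtP Y 0) Y0 => // y0 _ _.
  have D1 : X - Y < 0 by lra.
  by rewrite ltr_ndivlMr // ltr_ndivrMr //; apply/andP; split; lra.
have D1 : 0 < X - Y by lra.
by rewrite ltr_pdivlMr // ltr_pdivrMr //; apply/andP; split; lra.
Qed.

Definition rays_parity l v : bool := \big[addb/false]_r right_of l r v.

Lemma int_edge_parity l e : gauge_direction G l ->
  ~~ (is_bdry (tail e) && is_bdry (head e)) ->
  odd (int_edge l e) = (rays_parity l (tail e) (+) rays_parity l (head e)) (+)
    [exists r, tail e == bdry G (src G r)] && (cross l (vec e) < 0).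
Proof.
move=> gl nb; rewrite /int_edge odd_card /rays_parity -big_split /=.
under eq_bigr do rewrite crossing_parity //.
rewrite big_split /=; congr (_ (+) _).
case: existsP => [[r /eqP tr]|nr] /=; last first.
  rewrite big1 // => r _; case: eqP => //= tr.
  by case: nr; exists r; apply/eqP.
rewrite (bigD1 r) //= tr eqxx /= big1 ?addbF // => r' nr.
rewrite [_ == _](_ : _ = false) //; apply: contraNF nr => /eqP[/esym] sr.
apply/eqP; have mono := src_incr Gp.
by case: (ltngtP r' r) => [/mono|/mono|/val_inj//]; rewrite sr ltnn.
Qed.

(** The sides of intermediate vertices cancel in pairs, and only the first edge can start at a
    source. *)
Lemma int_path_parity l e s : gauge_direction G l ->
  ~~ (is_bdry (tail e) && is_bdry (head e)) -> path (@consecutive _ _ _ G) e s ->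
  odd (int_path l (e :: s)) =
    (rays_parity l (tail e) (+) rays_parity l (head (last e s))) (+)
    [exists r, tail e == bdry G (src G r)] && (cross l (vec e) < 0).
Proof.
move=> gl; elim: s e => [|f s IH] e nb.
  by rewrite /int_path big_seq1 int_edge_parity.
case/andP=> ef pth; rewrite /int_path big_cons oddD int_edge_parity // -/(int_path _ _).
have tf := consecutive_inner ef.
rewrite IH //; last by rewrite (negPf tf).
rewrite [X in _ = _ (+) rays_parity l (head X) (+) _]/=.
have -> : [exists r, tail f == bdry G (src G r)] = false.
  by apply/negbTE/existsPn => r; apply: contraNneq tf => ->.
rewrite (eqP ef) addbF; move: ([exists r, _] && _).
by do 3!case: (rays_parity _ _); case.
Qed.

Lemma last_head_bdry e s : path (@consecutive _ _ _ G) e s ->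
  ~~ (is_bdry (tail e) && is_bdry (head e)) -> is_bdry (head (last e s)) ->
  ~~ is_bdry (tail (last e s)).
Proof.
elim: s e => [|f s IH] e /=; first by case: is_bdry => // _ /=; case: is_bdry.
case/andP=> ef pth _; apply: IH => //.
by rewrite (negPf (consecutive_inner ef)).
Qed.

(** * Edge signs for two gauge directions *)

Section Comparison.
Variables l l' : R * R.
Hypotheses (gl : gauge_direction G l) (gl' : gauge_direction G l').

(** This holds ray by ray: [l], [l'] and the vector [w] from the source to [v] all point below the
    interval, so [w] is in the cone of [l] and [l'] exactly when it lies on different sides of
    them. *)
Lemma cr_parity v : ~~ is_bdry v ->
  odd (cr l l' v) = rays_parity l v (+) rays_parity l' v.
Proof.
move=> nv; rewrite /cr odd_card /rays_parity -big_split /=.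
apply: eq_bigr => r _; rewrite /right_of; set w := pos v - _.
have nvr : v != bdry G (src G r) by apply: contraNneq nv => ->.
have lw : cross l w != 0 by apply: right_of_neq0.
have lw' : cross l' w != 0 by apply: right_of_neq0.
have wl' : cross w l' != 0 by rewrite crossC oppr_eq0.
have dl := gauge_below (src G r) gl; have dl' := gauge_below (src G r) gl'.
have dw : cross d w < 0 by rewrite htB [ht (bdry _ _)]ht_bdry // subr0 ht_inner.
transitivity (between l l' w).
  apply/asboolP/idP => [[t [q [t01 q0 ev]]]|].
    have ew : w = q *: rotation l l' t by rewrite /w ev addrC addKr.
    apply/(in_rotationP lw wl'); exists t, q; split=> //.
    (* [cr] allows [q = 0], but [v] is not the source. *)
    rewrite lt0r q0 andbT; apply: contraNneq lw => q00.
    by rewrite ew q00 scale0r /cross !mulr0 subr0.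
  case/(in_rotationP lw wl') => t [q [t01 q0 ew]]; exists t, q; split=> //.
    exact: ltW.
  by rewrite -ew addrC subrK.
have e := cross_plucker d w l l'; rewrite /between [cross w l']crossC oppr_gt0 oppr_lt0.
(* Once [w] lies on different sides of [l] and [l'], this relation forces the sign of
   [cross l l']. *)
have e' : cross d w * cross l l' = cross d l' * cross l w - cross d l * cross l' w.
  by rewrite e [cross w l]crossC [cross w l']crossC; ring.
have m (a b : R) : a < 0 -> 0 < b -> a * b < 0 by move=> a0; rewrite nmulr_rlt0.
have m' (a b : R) : a < 0 -> b < 0 -> 0 < a * b by move=> a0; rewrite nmulr_rgt0.
case: (ltgtP (cross l w) 0) lw => // a _; case: (ltgtP (cross l' w) 0) lw' => // b _;
  rewrite ?andbF ?andbT ?orbF //=.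
  apply/idP; rewrite ltNge; apply/negP => D; move: (m' _ _ dl' a) (m _ _ dl b).
  by have := mulr_le0_ge0 (ltW dw) D; lra.
apply/idP; rewrite ltNge; apply/negP => D; move: (m _ _ dl' a) (m' _ _ dl b).
by have := mulr_le0 (ltW dw) D; lra.
Qed.

Lemma par_between e : par l l' e = between l l' (vec e) :> nat.
Proof.
have vl' : cross (vec e) l' != 0 by rewrite crossC oppr_eq0; apply: cross_vec_gauge.
rewrite /par; congr nat_of_bool; apply/asboolP/idP => h.
  exact/(in_rotationP (cross_vec_gauge e gl) vl').
exact/(in_rotationP (cross_vec_gauge e gl) vl').
Qed.

Lemma gauge_change_parity e s j : ~~ is_bdry (tail e) ->
  path (@consecutive _ _ _ G) e s -> head (last e s) = bdry G j ->
  oddz (wind l' (e :: s) + (int_path l' (e :: s))%:Z) =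
  oddz (wind l (e :: s) + (int_path l (e :: s))%:Z) (+)
  odd (cr l l' (tail e) + par l l' e).
Proof.
move=> te pth hl; have nb : ~~ (is_bdry (tail e) && is_bdry (head e)) by rewrite (negPf te).
have dl := gauge_below j gl; have dl' := gauge_below j gl'.
rewrite !oddzD oddD cr_parity // par_between oddb.
have oddzN (m : nat) : oddz m = odd m by [].
rewrite !oddzN !int_path_parity // hl.
have -> : [exists r, tail e == bdry G (src G r)] = false.
  by apply/negbTE/existsPn => r; apply: contraNneq te => ->.
have -> : rays_parity l' (bdry G j) = rays_parity l (bdry G j).
  by apply: eq_bigr => r _; rewrite !right_of_bdry.
have := wind_parity gl gl' pth.
(* The last edge ends on the interval, so it cannot point below it as the whole cone does. *)
have -> : between l l' (vec (last e s)) = false.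
  apply/negP => /(between_below dl dl'); rewrite ht_vec hl ht_bdry // sub0r oppr_lt0.
  by rewrite ltNge ht_le0.
by do 2!case: (oddz _); do 3!case: (rays_parity _ _); case: (between _ _ _) => //=; case: (rays_parity _ _).
Qed.

End Comparison.

(** * Edges along the boundary and topological winding *)

Lemma wind_top_bdry_edge e i j : tail e = bdry G i -> head e = bdry G j ->
  wind_top i j [:: e] = 0.
Proof.
move=> te he; rewrite /wind_top /= big_nil add0r.
have [c [cE cP cN]] := bdry_diff.
have ve : vec e = c i j *: d by rewrite -cE /vec te he.
have c0 : c i j != 0 by apply: contraNneq (vec_neq0 e) => c0; rewrite ve c0 scale0r.
have -> : ivl G - ivr G = (- (c i j)^-1) *: vec e.
  by rewrite ve scalerA mulNr mulVf // scaleN1r opprB.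
have v0 := vec_neq0 e; set w := _ *: vec e.
have w0 : w != 0 by rewrite scaler_eq0 negb_or v0 oppr_eq0 invr_eq0 c0.
have we : turn w (vec e) = turn w (- c i j *: w).
  by rewrite /w scalerA mulrNN divff // scale1r.
rewrite {}we {1}/w.
have pi0 : 2 * pi != 0 :> R by rewrite mulf_neq0 ?gt_eqF ?pi_gt0.
(* If [j < i] neither corner turns and the arc around the disk contributes 2 pi; if [i < j] each
   corner is a reversal, counted as pi by the convention in [turn]. *)
case: (ltgtP (c i j) 0) c0 => // cij _; rewrite -?cP -?cN.
  rewrite (lt_gtF cij) turn_parallel ?oppr_gt0 ?invr_lt0 // add0r.
  by rewrite turn_parallel ?oppr_gt0 // addr0 divff // subrr floor0.
rewrite cij !turn_opposite ?oppr_lt0 ?invr_gt0 // addr0 -mulr2n mulr_natl divff ?subrr ?floor0 //.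
by rewrite -mulr_natl.
Qed.

(** Such a source would lie on the segment of [e] without being one of its ends, against planarity;
    so [sigma] vanishes for an edge along the interval. *)
Lemma no_source_between e i j r : tail e = bdry G i -> head e = bdry G j ->
  ~~ (minn i j < src G r < maxn i j)%N.
Proof.
move=> te he; apply/negP => /andP[r1 r2].
have [f tf _] := src_edge r.
have [t [t_incr _ pt]] := boundary_pos Gp.
have ri : bdry G (src G r) != bdry G i.
  by apply/eqP => -[ri]; move: r1 r2; rewrite ri; lia.
have rj : bdry G (src G r) != bdry G j.
  by apply/eqP => -[rj]; move: r1 r2; rewrite rj; lia.
have nef : e != f by apply: contraNneq ri => ef; rewrite -te ef tf.
have xf : segment (pos (tail f)) (pos (head f)) (pos (bdry G (src G r))).
  by exists 0; rewrite ?lexx ?ler01 // scale0r addr0 tf.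
have xe : segment (pos (tail e)) (pos (head e)) (pos (bdry G (src G r))).
  rewrite te he !pt; set x := src G r in r1 r2 *.
  exists ((t x - t i) / (t j - t i)).
    case: (ltngtP i j) r1 r2 => [ij|ji|ij] r1 r2; last by have := ltn_trans r1 r2; rewrite ltnn.
      have := t_incr _ _ ij; have := t_incr _ _ r1; have := t_incr _ _ r2 => h1 h2 h3.
      by rewrite ler_pdivlMr ?ler_pdivrMr ?subr_gt0 //; apply/andP; split; lra.
    have := t_incr _ _ ji; have := t_incr _ _ r1; have := t_incr _ _ r2 => h1 h2 h3.
    by rewrite ler_ndivlMr ?ler_ndivrMr ?subr_lt0 //; apply/andP; split; lra.
  have nt : t j - t i != 0.
    rewrite subr_eq0; case: (ltngtP i j) r1 r2 => [ij|ji|ij] r1 r2.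
    - by rewrite gt_eqF ?t_incr.
    - by rewrite lt_eqF ?t_incr.
    - by have := ltn_trans r1 r2; rewrite ltnn.
  rewrite -addrA; congr (_ + _); rewrite opprD addrACA subrr add0r -scalerBl.
  by rewrite scalerA divfK // -scalerDl [t i + _]addrC subrK.
have [v [ve _ /(pos_inj Gp) ev]] := planar Gp nef xe xf.
move: ve; rewrite -ev /incident te he eq_sym (negPf ri) eq_sym (negPf rj) //.
Qed.

Section TopologicalWinding.
Variable l : R * R.
Hypothesis gl : gauge_direction G l.

Lemma total_turning e s : path (@consecutive _ _ _ G) e s ->
  \sum_(a <- pairmap (fun f g => turn (vec f) (vec g)) e s) a =
  turn (- l) (vec (last e s)) - turn (- l) (vec e) +
  2 * pi * (wind l (e :: s))%:~R :> R.
Proof.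
have cr (f : edge G) : cross (vec f) l != 0.
  by rewrite crossC oppr_eq0; apply: cross_vec_gauge.
elim: s e => [|f s IH] e.
  by rewrite /wind /= !big_nil subrr mulr0 addr0.
move=> /andP[ef pth]; rewrite wind_cons /= big_cons IH //.
rewrite (turn_wind (cr e) (cr f) (nopp_consecutive ef)) intrD; ring.
Qed.

(** The two corners with the boundary direction [tau] cancel the remaining angles. The final corner
    has winding 0 and the initial one has winding 1 exactly when [e] leaves to the left of [l];
    together with the -1 in [wind_top] this leaves the indicator of leaving to the right. *)
Lemma wind_top_wind e s i j : tail e = bdry G i -> ~~ is_bdry (head e) ->
  path (@consecutive _ _ _ G) e s -> head (last e s) = bdry G j -> i != j ->
  oddz (wind_top i j (e :: s)) =
  oddz (wind l (e :: s)) (+) (cross l (vec e) < 0) (+) (j < i)%N.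
Proof.
move=> te he pth hl ij; rewrite /wind_top.
have nb : ~~ (is_bdry (tail e) && is_bdry (head e)) by rewrite (negPf he) andbF.
have tl : ~~ is_bdry (tail (last e s)) by apply: last_head_bdry => //; rewrite hl.
have dl := gauge_below j gl.
have cr (f : edge G) : cross (vec f) l != 0.
  by rewrite crossC oppr_eq0; apply: cross_vec_gauge.
have de : cross d (vec e) < 0 by rewrite ht_vec te [ht (bdry _ _)]ht_bdry // subr0 ht_inner.
have dlast : 0 < cross d (vec (last e s)).
  by rewrite ht_vec hl [ht (bdry _ _)]ht_bdry // sub0r oppr_gt0 ht_inner.
rewrite total_turning //; set tau := ivl G - ivr G.
have tauE (x : R * R) : cross tau x = - cross d x.
  by rewrite /tau -opprB -scaleN1r crossZl mulN1r.
have taul : cross tau l != 0 by rewrite tauE oppr_eq0 lt_eqF.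
have taue : cross tau (vec e) != 0 by rewrite tauE oppr_eq0 lt_eqF.
have ltau : cross (vec (last e s)) tau != 0 by rewrite crossC tauE opprK gt_eqF.
rewrite (turn_wind (cr (last e s)) taul (nopp_cross ltau)).
rewrite (turn_wind taul (cr e) (nopp_cross taue)).
have -> : windv l (vec (last e s)) tau = 0.
  rewrite /windv /orient [cross _ tau]crossC [cross l tau]crossC !tauE !opprK.
  by rewrite (gtr0_sgz dlast) (ltr0_sgz dl) andbF.
have -> : windv l tau (vec e) = (0 < cross l (vec e)).
  have te0 : 0 < cross tau (vec e) by rewrite tauE oppr_gt0.
  have tl0 : 0 < cross tau l by rewrite tauE oppr_gt0.
  rewrite /windv /orient (gtr0_sgz te0) (gtr0_sgz tl0) eqxx /=.
  by case: sgzP.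
set z := wind l (e :: s).
have pi0 : 2 * pi != 0 :> R by rewrite mulf_neq0 ?gt_eqF ?pi_gt0.
rewrite [X in Num.floor X](_ : _ = (z + (0 < cross l (vec e))%R + (j < i)%N - 1)%:~R).
  rewrite intrKfloor !oddzD.
  have := cross_vec_gauge e gl.
  by case: (ltgtP (cross l (vec e)) 0) => //= _ _; case: (oddz z); case: (j < i)%N.
apply: (mulfI pi0); rewrite mulrBr mulrC divfK // !intrD.
case: (ltngtP i j) ij => [||/val_inj->]; rewrite ?eqxx // => ij _; rewrite -!pmulrn mulr0n ?mulr1n; ring.
Qed.

Lemma boundary_path_parity e s r j : tail e = bdry G (src G r) ->
  j \notin codom (@src R k n G) ->
  path (@consecutive _ _ _ G) e s -> head (last e s) = bdry G j ->
  oddz (wind l (e :: s) + (int_path l (e :: s))%:Z) =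
  oddz (wind_top (src G r) j (e :: s)) (+) odd (sigma G r j).
Proof.
move=> te jn pth hl.
have jsrc r' : src G r' != j by apply: contraNneq jn => <-; apply: codom_f.
have oddzN (m : nat) : oddz m = odd m by [].
(* A first edge ending on the boundary is the whole walk; running along the interval, it meets no
   ray at [t > 0]. *)
case: (boolP (is_bdry (head e))) => he.
  have s0 : s = [::].
    case: s pth {hl} => // f s /andP[/eqP ef _].
    by have := @consecutive_inner e f; rewrite /consecutive ef eqxx -ef he => /(_ isT).
  have {}hl : head e = bdry G j by move: hl; rewrite s0.
  rewrite s0 (wind_top_bdry_edge te hl) /wind /= big_nil add0r oddzN /int_path big_seq1.
  have -> : sigma G r j = 0%N.
    by apply: eq_card0 => r'; rewrite inE (negPf (no_source_between r' te hl)).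
  rewrite /int_edge odd_card big1 // => r' _; apply/asboolP => -[t t0 [a _ ea]].
  have := gauge_below j gl; rewrite -(pmulr_rlt0 _ t0) -crossZr.
  have -> : t *: l = pos (tail e) - pos (bdry G (src G r')) + a *: vec e.
    by rewrite addrAC -ea addrC addKr.
  rewrite crossDr crossZr htB ht_vec te hl !ht_bdry // subrr mulr0 addr0 ltxx //.
have nb : ~~ (is_bdry (tail e) && is_bdry (head e)) by rewrite (negPf he) andbF.
rewrite oddzD oddzN int_path_parity // (wind_top_wind te he pth hl (jsrc r)) te hl.
have -> : [exists r', bdry G (src G r) == bdry G (src G r')] by apply/existsP; exists r.
suff -> : odd (sigma G r j) = (rays_parity l (bdry G (src G r)) (+)
    rays_parity l (bdry G j)) (+) (j < src G r)%N.
  case: (oddz _); case: (cross l _ < 0); do 2!case: (rays_parity _ _); by case: (_ < _)%N.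
rewrite odd_card /rays_parity -big_split /=.
(* Placing this term at the index [r' = r] reduces the identity to a comparison of positions for
   each ray. *)
have -> : (j < src G r)%N = \big[addb/false]_r' ((r' == r) && (j < src G r)%N).
  rewrite (bigD1 r) //= eqxx big1 ?addbF // => r' /negPf-> //.
rewrite -big_split; apply: eq_bigr => r' _ /=; rewrite !right_of_bdry //.
have -> : (r' == r) = (src G r' == src G r :> nat).
  have mono := src_incr Gp; case: (ltngtP r' r) => [h|h|/val_inj->].
  - by have := mono _ _ h; case: (ltngtP (src G r')) => // _ _; apply/negbTE; rewrite neq_ltn h.
  - by have := mono _ _ h; case: (ltngtP (src G r')) => // _ _; apply/negbTE; rewrite neq_ltn h orbT.
  - by rewrite !eqxx.
have := jsrc r'; have := jsrc r; rewrite -!(inj_eq val_inj) /=.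
by case: (ltngtP (src G r) j) => //; case: (ltngtP (src G r') j) => //;
   case: (ltngtP (src G r') (src G r)) => //; lia.
Qed.

End TopologicalWinding.
End PlabicGeometry.

(** * Row echelon form and edge vectors *)

Lemma grref_represents (R : realType) (k n : nat) (N : plabic_network R k n)
    (A : 'M[R]_(k, n)) : represents N A ->
  grref (@src R k n N) A = boundary_measurement N.
Proof.
case=> g ug ->; rewrite /grref.
(* The pivot columns of the boundary measurement matrix form the identity, so those of its multiple
   by [g] form [g]. *)
have -> : colsub (@src R k n N) (g *m boundary_measurement N) = g.
  have -> : colsub (@src R k n N) (g *m boundary_measurement N) =
      g *m colsub (@src R k n N) (boundary_measurement N).
    by apply/matrixP => a b; rewrite !mxE; apply: eq_bigr => c _; rewrite !mxE.
  rewrite (_ : colsub _ _ = 1%:M) ?mulmx1 //; apply/matrixP => r r'.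
  rewrite !mxE codom_f; have mono := src_incr (graph_plabic N).
  congr (_%:R); case: (ltngtP r r') => [h|h|/val_inj->]; last by rewrite !eqxx.
  - by rewrite -!val_eqE /= (ltn_eqF h) (ltn_eqF (mono _ _ h)).
  - by rewrite -!val_eqE /= (gtn_eqF h) (gtn_eqF (mono _ _ h)).
by rewrite mulmxA mulVmx // mul1mx.
Qed.

Section EdgeVectors.
Variables (R : realType) (k n : nat) (N : plabic_network R k n).
Let Gp := graph_plabic N.

Lemma edge_vector_src (l : R * R) (r : 'I_k) (e : edge N) :
  gauge_direction N l -> tail e = bdry N (src N r) ->
  edge_vector l e = row r (boundary_measurement N) - delta_mx 0 (src N r).
Proof.
move=> gl te; apply/rowP => j; rewrite !mxE eqxx /=.
case: ifPn => [/codomP [r' ej]|jn].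
  (* In a pivot column the matrix entry cancels against [delta_mx], and no walk ends at a source. *)
  have [f tf _] := src_edge Gp r'.
  rewrite [j == _]eq_sym subrr; apply: walk_sum0 => -[|g s] //=.
  apply/negP => /and3P[_ _ /eqP hl]; apply: (bdry_head_tail Gp hl).
  by rewrite ej; exact: tf.
have -> : (j == src N r) = false by apply: contraNF jn => /eqP->; apply: codom_f.
rewrite subr0 -signr_odd; apply: walk_sum_sign.
  (* Only one edge leaves a source, so walks from it are the paths with first edge [e]. *)
  case=> // f s /=; have [g _ gu] := src_edge Gp r.
  congr andb; apply/eqP/eqP => [->//|tf].
  by rewrite (gu f tf) (gu e te).
case=> // f s /and3P[/eqP tf pth /eqP hl].
exact: (boundary_path_parity Gp gl tf jn pth hl).
Qed.

Lemma edge_vector_gauge_change (l l' : R * R) (e : edge N) :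
  gauge_direction N l -> gauge_direction N l' -> ~~ is_bdry (tail e) ->
  edge_vector l' e = (-1) ^+ (cr l l' (tail e) + par l l' e) *: edge_vector l e.
Proof.
move=> gl gl' te; apply/rowP => j; rewrite !mxE -signr_odd.
apply: walk_sum_sign => // -[|f s] // /and3P[/eqP-> pth /eqP hl].
exact: (gauge_change_parity Gp gl gl' te pth hl).
Qed.

End EdgeVectors.

Theorem proposition5p1 (R : realType) (k n : nat) (hk : (0 < k)%N) (hkn : (k < n)%N)
    (N : plabic_network R k n) (A : 'M[R]_(k, n)) (hA : represents N A)
    (l l' : R * R) (hl : gauge_direction N l) (hl' : gauge_direction N l') :
  (forall (r : 'I_k) (e : edge N), tail e = bdry N (src N r) ->
     edge_vector l e = edge_vector l' e /\
     edge_vector l e = row r (grref (@src R k n N) A) - delta_mx 0 (src N r))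
  /\
  (forall e : edge N, (forall r : 'I_k, tail e <> bdry N (src N r)) ->
     edge_vector l' e =
       (-1) ^+ (cr l l' (tail e) + par l l' e) *: edge_vector l e).
Proof.
split=> [r e te|e te].
  by rewrite (grref_represents hA) !(edge_vector_src _ te).
apply: edge_vector_gauge_change => //.
(* A boundary vertex with an outgoing edge is a source, so the remaining edges start at inner
   vertices. *)
case et : (tail e) => [j|//]; exfalso.
have jsrc : j \in codom (@src R k n N).
  rewrite (src_sources (graph_plabic N)).
  have := boundary_degree (graph_plabic N) j.
  have : (0 < outdeg (bdry N j))%N by apply/card_gt0P; exists e; rewrite inE et.
  by case: outdeg => [|[|b]] //; rewrite addnS => _ [] /eqP; rewrite addnS.
by case/codomP: jsrc => r ej; apply: (te r); rewrite et ej.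
Qed.
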